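(* Let $\mathcal{X} = (X,\omega_X,\nu)$ and $\mathcal{Y} = (Y,\omega_Y,\mu)$ be two finite measure networks, with $X=\{x_1,\dots,x_n\}$, $Y=\{y_1,\dots,y_m\}$, $\nu = \sum_{i=1}^n a_i\delta_{x_i}$ and $\mu=\sum_{j=1}^m b_j\delta_{y_j}$, where $a_i>0$ for all $i$. Let $\gamma\in U(a,b)$ be a Gromov-Wasserstein optimal coupling of $\mathcal{X}$ and $\mathcal{Y}$. Define $B_{jl}=\omega_Y(y_j,y_l)$ and $$C_{ik}=\sum_{j,l=1}^m \frac{\gamma_{ij}}{a_i}\frac{\gamma_{kl}}{a_k}B_{jl},$$ and let $\mathcal{T}=(X,\omega_C,\nu)$, with $\omega_C(x_i,x_k)=C_{ik}$, be the GW barycentric projection of $\mathcal{Y}$ with respect to $\mathcal{X}$ (induced by $\gamma$). Then $$GW_2^2(\mathcal{X},\mathcal{Y}) = GW_2^2(\mathcal{X},\mathcal{T}) + \sum_{i,k=1}^n\sum_{j,l=1}^m \gamma_{ij}\gamma_{kl}\,|C_{ik}-B_{jl}|^2 = GW_2^2(\mathcal{X},\mathcal{T}) + \big(\mathrm{diam}_2(\mathcal{Y})^2-\mathrm{diam}_2(\mathcal{T})^2\big).$$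
   Context: A finite measure network is a triple $(X,\omega_X,\nu)$ where $X=\{x_1,\dots,x_n\}$ is a finite set, $\nu=\sum_{i=1}^n a_i\delta_{x_i}$ is a probability measure on $X$, and $\omega_X:X\times X\to\mathbb{R}$ is any function (no symmetry or metric property is assumed). For weight vectors $a\in\mathbb{R}^n$, $b\in\mathbb{R}^m$ (nonnegative entries summing to 1), couplings are identified with matrices in $$U(a,b)=\Big\{\gamma\in\mathbb{R}^{n\times m}: \gamma_{ij}\ge 0,\ \sum_{i=1}^n\gamma_{ij}=b_j,\ \sum_{j=1}^m\gamma_{ij}=a_i\ \ \forall i,j\Big\}.$$ For finite measure networks $\mathcal{X}=(X,\omega_X,\nu)$ and $\mathcal{Y}=(Y,\omega_Y,\mu)$ with weights $a,b$, the squared 2-Gromov-Wasserstein distance is $$GW_2^2(\mathcal{X},\mathcal{Y})=\min_{\gamma\in U(a,b)}\sum_{i,j,k,l}\gamma_{ij}\gamma_{kl}\,|\omega_X(x_i,x_k)-\omega_Y(y_j,y_l)|^2,$$ and a $\gamma$ attaining the minimum is called a Gromov-Wasserstein optimal coupling. The 2-diameter of a measure network is $$\mathrm{diam}_2(\mathcal{X})=\Big(\iint_{X\times X}\omega_X(x,x')^2\,\nu(dx)\,\nu(dx')\Big)^{1/2},$$ which for a finite network equals $\big(\sum_{i,k}a_ia_k\,\omega_X(x_i,x_k)^2\big)^{1/2}$. *)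

(* Defs.v *)
From HB Require Import structures.
From mathcomp Require Import all_boot all_order all_algebra.
From mathcomp Require Import all_classical all_reals all_analysis.

Set Implicit Arguments.
Unset Strict Implicit.
Unset Printing Implicit Defensive.

Import Order.TTheory GRing.Theory Num.Theory.
Import numFieldNormedType.Exports.

Local Open Scope classical_set_scope.
Local Open Scope ring_scope.

(* MathComp-Analysis requires measurable types to be pointed.  The point plays
   no role below, and a set carrying a probability measure is nonempty. *)
#[short(type="finPointedType")]
HB.structure Definition FinPointed := {T of Finite T & Pointed T}.

Definition discrete (X : finPointedType) : Type := X.

HB.instance Definition _ (X : finPointedType) :=
  FinPointed.copy (discrete X) X.
HB.instance Definition _ (X : finPointedType) :=
  @isMeasurable.Build default_measure_display (discrete X)
    discrete_measurable discrete_measurable0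
    discrete_measurableC discrete_measurableU.

Record network (R : realType) := Network {
  carrier :> finPointedType;
  omega : carrier -> carrier -> R;
  nu : probability (discrete carrier) R
}.
Arguments Network {R carrier} omega nu.
Arguments omega {R} _ _ _.
Arguments nu {R} _.

(* The weights a_i in nu = \sum_i a_i \d_(x_i). *)
Definition weight (R : realType) (X : network R) (x : X) : R :=
  fine (nu X [set x]).
Arguments weight {R} X x.

(* Matrices in R^(n x m) are indexed by the points of X and Y themselves. *)
Definition coupling (R : realType) (X Y : network R) : set (X -> Y -> R) :=
  [set g | [/\ forall i j, 0 <= g i j,
               forall j, \sum_i g i j = weight Y j
             & forall i, \sum_j g i j = weight X i]].

Definition gw_cost (R : realType) (X Y : network R) (g : X -> Y -> R) : R :=
  \sum_(i : X) \sum_(j : Y) \sum_(k : X) \sum_(l : Y)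
    g i j * g k l * `|omega X i k - omega Y j l| ^+ 2.

Definition gw_optimal (R : realType) (X Y : network R) (g : X -> Y -> R) :=
  coupling g /\ forall h : X -> Y -> R, coupling h -> gw_cost g <= gw_cost h.

(* The infimum is a minimum: see GW2sq_attained. *)
Definition GW2sq (R : realType) (X Y : network R) : R :=
  inf (@gw_cost R X Y @` @coupling R X Y).

Definition diam2 (R : realType) (X : network R) : R :=
  Num.sqrt (\int[nu X]_x \int[nu X]_x' (omega X x x' ^+ 2)).

Definition barycentric_cost (R : realType) (X Y : network R)
    (g : X -> Y -> R) (i k : X) : R :=
  \sum_(j : Y) \sum_(l : Y)
    g i j / weight X i * (g k l / weight X k) * omega Y j l.

Definition barycentric_projection (R : realType) (X Y : network R)
    (g : X -> Y -> R) : network R :=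
  Network (barycentric_cost g) (nu X).

Section facts.
Variable R : realType.
Implicit Types X Y : network R.

Lemma weight_ge0 X (x : X) : 0 <= weight X x.
Proof. by rewrite /weight fine_ge0. Qed.

Lemma weightE X (x : X) : nu X [set x] = (weight X x)%:E.
Proof. by rewrite /weight fineK// fin_num_measure. Qed.

Lemma setT_bigU X :
  [set: discrete X] = \big[setU/set0]_(x <- enum X) [set x].
Proof.
apply/seteqP; split=> // x _; rewrite -bigcup_seq.
by exists x => //=; rewrite mem_enum.
Qed.

Lemma trivIset_set1 (T : Type) (D : set T) : trivIset D (@set1 T).
Proof. by move=> i j _ _ [x [/= -> ->]]. Qed.

Lemma ge0_integral_nu X (f : X -> R) : (forall x, 0 <= f x) ->
  (\int[nu X]_x (f x)%:E = (\sum_(x : X) weight X x * f x)%:E)%E.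
Proof.
move=> f0; rewrite setT_bigU ge0_integral_bigsetU//=; first last.
- by move=> x _; rewrite lee_fin.
- exact: trivIset_set1.
- exact: enum_uniq.
rewrite -[in RHS]big_enum/= -sumEFin; apply: eq_bigr => x _.
rewrite (eq_integral (cst (f x)%:E)); last by move=> y; rewrite inE => ->.
by rewrite integral_cst// [X in (_ * X)%E]weightE -EFinM mulrC.
Qed.

Lemma weight_sum1 X : \sum_(x : X) weight X x = 1.
Proof.
have := @ge0_integral_nu X (fun=> 1) (fun=> ler01).
rewrite [LHS](integral_cst (nu X) measurableT 1%:E) mul1e.
rewrite [LHS]probability_setT => -[->].
by apply: eq_bigr => x _; rewrite mulr1.
Qed.

Lemma nuE X (A : set X) :
  nu X A = (\sum_(x : X) (weight X x)%:E * \d_(x : discrete X) A)%E.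
Proof.
have := @ge0_integral_nu X (\1_A) (fun=> ler0n _ _).
rewrite [LHS](integral_indic (nu X) measurableT) ?setIT// => ->.
by rewrite -sumEFin; apply: eq_bigr => x _; rewrite EFinM.
Qed.

Lemma diam2_sum X :
  diam2 X = Num.sqrt (\sum_(i : X) \sum_(k : X)
                        weight X i * weight X k * omega X i k ^+ 2).
Proof.
rewrite /diam2; congr Num.sqrt.
have intE (f : X -> R) : (forall x, 0 <= f x) ->
    \int[nu X]_x f x = \sum_(x : X) weight X x * f x.
  by move=> f0; rewrite /Rintegral ge0_integral_nu.
rewrite (@eq_Rintegral _ _ _ (nu X) _
           (fun x : X => \sum_(k : X) weight X k * omega X x k ^+ 2)).
  rewrite intE.
    apply: eq_bigr => i _; rewrite mulr_sumr.
    by apply: eq_bigr => k _; rewrite mulrA.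
  by move=> x; apply: sumr_ge0 => k _; rewrite mulr_ge0 ?weight_ge0 ?sqr_ge0.
by move=> x _ /=; rewrite intE// => k; exact: sqr_ge0.
Qed.

Lemma gw_optimal_cost X Y (g : X -> Y -> R) :
  gw_optimal g -> gw_cost g = GW2sq X Y.
Proof.
move=> [cg ming]; apply/eqP; rewrite eq_le; apply/andP; split.
  apply: lb_le_inf; first by exists (gw_cost g), g.
  by move=> _ [h ch <-]; exact: ming.
apply: ge_inf; last by exists g.
by exists (gw_cost g) => _ [h ch <-]; exact: ming.
Qed.

Lemma coupling_prod X Y : @coupling R X Y (fun i j => weight X i * weight Y j).
Proof.
split=> [i j|j|i]; first by rewrite mulr_ge0 ?weight_ge0.
- by rewrite -mulr_suml weight_sum1 mul1r.
- by rewrite -mulr_sumr weight_sum1 mulr1.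
Qed.

Lemma GW2sq_attained X Y :
  exists2 g : X -> Y -> R, gw_optimal g & gw_cost g = GW2sq X Y.
Proof.
pose M := prod_topology (fun _ : (X * Y)%type => R^o).
pose gd (g : M) : X -> Y -> R := fun i j => g (i, j).
have ev p : continuous (fun g : M => g p : R^o) by exact: proj_continuous.
have csum (I : finType) (F : I -> M -> R^o) :
    (forall i, continuous (F i)) -> continuous (fun g => \sum_i F i g).
  by move=> cF; apply: continuous_big => //; exact: add_continuous.
pose A : set M := [set g | coupling (gd g)].
have cA : compact A.
  apply: (@subclosed_compact M _ [set g : M | forall p, (`[0, 1]%classic : set R^o) (g p)]).
  - rewrite (_ : A = (\bigcap_p ((fun g : M => g p) @^-1` [set r | 0 <= r]))
        `&` (\bigcap_j ((fun g : M => \sum_i g (i, j)) @^-1` [set weight Y j]))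
        `&` (\bigcap_i ((fun g : M => \sum_j g (i, j)) @^-1` [set weight X i]))).
      have clpre (f : M -> R^o) (D : set R^o) :
          continuous f -> closed D -> closed (f @^-1` D).
        by move=> cf cD; apply: preimage_closed => // g _; exact: cf.
      by apply: closedI; [apply: closedI|]; apply: closed_bigI => p _;
        apply: clpre; do ?[exact: ev|exact: closed_ge|exact: closed_eq|
                           apply: csum => ?].
    apply/seteqP; split=> [g [g0 gY gX]|g [[g0 gY] gX]].
      by split; [split|] => [[i j] _|j _|i _]; [exact: g0|exact: gY|exact: gX].
    by split=> [i j|j|i]; [exact: (g0 (i, j))|exact: gY|exact: gX].
  - exact: (tychonoff (fun=> @segment_compact R 0 1)).
  - move=> g [g0 gY gX] [i j] /=; rewrite in_itv/= g0/=.
    apply: (@le_trans _ _ (weight X i)).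
      by rewrite -gX (bigD1 j)//= lerDl sumr_ge0// => k _; exact: g0.
    rewrite -(weight_sum1 X) (bigD1 i)//= lerDl sumr_ge0// => k _.
    exact: weight_ge0.
have A0 : A !=set0.
  by exists (fun p => weight X p.1 * weight Y p.2); exact: coupling_prod.
have cf : continuous (fun g : M => gw_cost (gd g) : R^o).
  apply: (csum X) => i; apply: (csum Y) => j.
  apply: (csum X) => k; apply: (csum Y) => l g.
  have c1 : {for g, continuous (fun g : M => (g (i, j) : R^o) * (g (k, l) : R^o) : R^o)}.
    apply: (@continuousM R M (fun g : M => g (i, j)) (fun g : M => g (k, l)) g).
      exact: ev.
    exact: ev.
  exact: (cvgMr_tmp c1).
have [g /set_mem Ag gmin] := compact_EVT_min A0 cA (continuous_subspaceT cf).
have gopt : gw_optimal (gd g).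
  split=> // h ch.
  by apply: (gmin (fun p => h p.1 p.2)); rewrite inE.
by exists (gd g) => //; exact: gw_optimal_cost.
Qed.

End facts.

(* Main.v *)
(* Composing a coupling of X and T with the disintegration gamma_pj / a_p of
   gamma gives a coupling of X and Y.  Since C_pq is the mean of B against
   (gamma_p / a_p) x (gamma_q / a_q), the bias-variance identity shows that
   this operation raises the cost by a constant, the second term of the
   theorem.  The diagonal coupling is sent to gamma, which is optimal, so the
   diagonal coupling is optimal too. *)
Require Import Defs.
From HB Require Import structures.
From mathcomp Require Import all_boot all_order all_algebra.
From mathcomp Require Import all_classical all_reals all_analysis.
From mathcomp Require Import ring.

Import Order.TTheory GRing.Theory Num.Theory.

Local Open Scope ring_scope.

(** The cross term vanishes because [m] is the mean of [f] under the weights [w]. *)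
Lemma bias_variance {R : comPzRingType} {I : finType} (w f : I -> R) (x : R) :
  \sum_i w i = 1 ->
  let m := \sum_i w i * f i in
  \sum_i w i * (x - f i) ^+ 2 = (x - m) ^+ 2 + \sum_i w i * (m - f i) ^+ 2.
Proof.
move=> w1 m.
(* The difference of the two squares is affine in [f i], so its weighted sum involves only the total
   weight 1 and the mean [m]. *)
have E i : w i * (x - f i) ^+ 2 = w i * (m - f i) ^+ 2
    + (w i * (x ^+ 2 - m ^+ 2) + (w i * f i) * (2%:R * (m - x))) by ring.
under eq_bigr do rewrite E.
rewrite !big_split/= -!mulr_suml w1 -/m; ring.
Qed.

(** Fubini for products of mixtures of the rows of [K]. It is used with rows of a coupling as [u]
    and [v] for the cost, and with the weights of X for the diameter. *)
Lemma sum_mixture {R : comPzRingType} {P J : finType} (K : P -> J -> R)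
    (u v : P -> R) (F : J -> J -> R) :
  \sum_j \sum_l (\sum_p u p * K p j) * (\sum_q v q * K q l) * F j l
  = \sum_p \sum_q u p * v q * \sum_j \sum_l K p j * K q l * F j l.
Proof.
under eq_bigr => j _ do under eq_bigr => l _ do
  rewrite big_distrlr/= mulr_suml.
under eq_bigr => j _ do rewrite exchange_big/=.
rewrite exchange_big/=; apply: eq_bigr => p _.
under eq_bigr => j _ do under eq_bigr => l _ do rewrite mulr_suml.
under eq_bigr => j _ do rewrite exchange_big/=.
rewrite exchange_big/=; apply: eq_bigr => q _.
rewrite mulr_sumr; apply: eq_bigr => j _.
rewrite mulr_sumr; apply: eq_bigr => l _; ring.
Qed.

Lemma gw_costE {R : realType} {X Y : network R} (g : X -> Y -> R) :
  gw_cost g = \sum_(i : X) \sum_(k : X) \sum_(j : Y) \sum_(l : Y)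
    g i j * g k l * (omega X i k - omega Y j l) ^+ 2.
Proof.
apply: eq_bigr => i _; rewrite exchange_big/=; apply: eq_bigr => k _.
by do 2![apply: eq_bigr => ? _]; rewrite real_normK ?num_real.
Qed.

Lemma diam2_sqr {R : realType} (X : network R) :
  diam2 X ^+ 2
  = \sum_(i : X) \sum_(k : X) weight X i * weight X k * omega X i k ^+ 2.
Proof.
rewrite diam2_sum sqr_sqrtr//; apply: sumr_ge0 => i _; apply: sumr_ge0 => k _.
by rewrite mulr_ge0 ?sqr_ge0// mulr_ge0 ?weight_ge0.
Qed.

(** The identity transport plan. It also couples X with T, which has the same points and weights. *)
Definition diag_coupling {R : realType} (X : network R) (i k : X) : R :=
  weight X i * (i == k)%:R.

Lemma sum_diagl {R : pzRingType} {I : finType} (f : I -> R) (i : I) :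
  \sum_k (i == k)%:R * f k = f i.
Proof.
rewrite (bigD1 i)//= eqxx mul1r big1 ?addr0// => k ki.
by rewrite eq_sym (negbTE ki) mul0r.
Qed.

Section projection.
Variables (R : realType) (X Y : network R) (gamma : X -> Y -> R).
Hypothesis weight_gt0 : forall i : X, 0 < weight X i.
Hypothesis gammaP : coupling gamma.

Let C := barycentric_cost gamma.
Let B := omega Y.
Let T := barycentric_projection gamma.
Let K (p : X) (j : Y) : R := gamma p j / weight X p.
(** The variance of [B] under the product of the conditional laws [K p] and [K q]. *)
Let D (p q : X) : R := \sum_j \sum_l K p j * K q l * (C p q - B j l) ^+ 2.

Let weightK (p : X) (x : R) : weight X p * (x / weight X p) = x.
Proof. by rewrite mulrC divfK// gt_eqF. Qed.

Let K_sum1 p : \sum_j K p j = 1.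
Proof. by case: gammaP => _ _ gX; rewrite -mulr_suml gX divff// gt_eqF. Qed.

(** This is [bias_variance] on Y x Y with the product weights, whose mean of [B] is [C p q] by
    definition. *)
Lemma kernel_bias_variance p q x :
  \sum_j \sum_l K p j * K q l * (x - B j l) ^+ 2 = (x - C p q) ^+ 2 + D p q.
Proof.
have w1 : \sum_(z : Y * Y) K p z.1 * K q z.2 = 1.
  rewrite -(pair_bigA _ (fun j l => K p j * K q l))/=.
  by under eq_bigr do rewrite -mulr_sumr K_sum1 mulr1.
have := bias_variance (fun z : Y * Y => K p z.1 * K q z.2)
  (fun z => B z.1 z.2) x w1.
rewrite /= -(pair_bigA _ (fun j l => K p j * K q l * B j l))/=.
rewrite -(pair_bigA _ (fun j l => K p j * K q l * (x - B j l) ^+ 2))/= => ->.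
rewrite -/(barycentric_cost gamma p q) -/(C p q).
by rewrite -(pair_bigA _ (fun j l => K p j * K q l * (C p q - B j l) ^+ 2)).
Qed.

Definition compose_coupling (pi : X -> T -> R) (i : X) (j : Y) : R :=
  \sum_(p : X) pi i p * K p j.

Lemma compose_couplingP pi : coupling pi -> coupling (compose_coupling pi).
Proof.
case: gammaP => g0 gY gX [pi0 piT piX]; split=> [i j|j|i].
- apply: sumr_ge0 => p _; apply: mulr_ge0; first exact: pi0.
  by rewrite divr_ge0// ltW.
- rewrite exchange_big/= -gY; apply: eq_bigr => p _.
  by rewrite -mulr_suml piT; exact: weightK.
- rewrite exchange_big/= -piX; apply: eq_bigr => p _.
  by rewrite -mulr_sumr K_sum1 mulr1.
Qed.

(** The weights of X cancel the denominators in [K]. *)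
Lemma weighted_variance : \sum_(p : X) \sum_(q : X) weight X p * weight X q * D p q
  = \sum_(p : X) \sum_(q : X) \sum_(j : Y) \sum_(l : Y)
        gamma p j * gamma q l * (C p q - B j l) ^+ 2.
Proof.
do 2![apply: eq_bigr => ? _]; rewrite mulr_sumr; apply: eq_bigr => j _.
rewrite mulr_sumr; apply: eq_bigr => l _.
by rewrite mulrA [X in X * _]mulrACA /K !weightK.
Qed.

Lemma gw_cost_compose pi : coupling pi ->
  gw_cost (compose_coupling pi) =
  gw_cost pi + \sum_(p : X) \sum_(q : X) weight X p * weight X q * D p q.
Proof.
move=> [_ piT _].
(* As [D p q] involves neither [i] nor [k], summing over them leaves only the second marginals of
   [pi], which are the weights of X. Hence the added term does not depend on [pi]. *)
have -> : \sum_(p : X) \sum_(q : X) weight X p * weight X q * D p q =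
    \sum_(i : X) \sum_(k : X) \sum_(p : X) \sum_(q : X) pi i p * pi k q * D p q.
  under [RHS]eq_bigr => i _ do rewrite exchange_big/=.
  rewrite [RHS]exchange_big/=; apply: eq_bigr => p _.
  under [RHS]eq_bigr => i _ do rewrite exchange_big/=.
  rewrite [RHS]exchange_big/=; apply: eq_bigr => q _.
  under [RHS]eq_bigr => i _ do rewrite -mulr_suml -mulr_sumr.
  by rewrite -!mulr_suml -[weight X p]piT -[weight X q]piT.
rewrite !gw_costE -big_split/=; apply: eq_bigr => i _.
rewrite -big_split/=; apply: eq_bigr => k _.
rewrite sum_mixture -big_split/=; apply: eq_bigr => p _.
rewrite -big_split/=; apply: eq_bigr => q _.
by rewrite kernel_bias_variance mulrDr.
Qed.

Lemma diag_couplingP : @coupling R X T (diag_coupling X).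
Proof.
split=> [i k|k|i]; first by rewrite mulr_ge0 ?weight_ge0.
- rewrite -[RHS](sum_diagl (weight X) k); apply: eq_bigr => i _.
  by rewrite /diag_coupling mulrC eq_sym.
- rewrite -[RHS](sum_diagl (fun=> weight X i) i); apply: eq_bigr => k _.
  by rewrite /diag_coupling mulrC.
Qed.

Lemma compose_diag : compose_coupling (diag_coupling X) = gamma.
Proof.
apply/funext => i; apply/funext => j.
rewrite /compose_coupling /diag_coupling.
under eq_bigr do rewrite -mulrA.
by rewrite -mulr_sumr (sum_diagl (fun p => K p j)); exact: weightK.
Qed.

(** A competitor [pi] composes to a competitor of [gamma], and the common constant cancels from the
    two costs. *)
Lemma diag_optimal : gw_optimal gamma -> @gw_optimal R X T (diag_coupling X).
Proof.
move=> [_ gmin]; split=> [|pi piP]; first exact: diag_couplingP.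
have := gmin _ (compose_couplingP _ piP).
rewrite -[X in gw_cost X <= _]compose_diag.
by rewrite !gw_cost_compose//; [rewrite lerD2r|exact: diag_couplingP].
Qed.

(** Variance is second moment minus squared mean, that is, [kernel_bias_variance] at 0, averaged
    over [p] and [q]. *)
Lemma variance_diam2 :
  \sum_(p : X) \sum_(q : X) weight X p * weight X q * D p q
  = diam2 Y ^+ 2 - diam2 T ^+ 2.
Proof.
apply/eqP; rewrite eq_sym subr_eq eq_sym addrC !diam2_sqr; apply/eqP.
have [_ gY _] := gammaP.
rewrite -big_split/=.
transitivity (\sum_(p : X) \sum_(q : X) weight X p * weight X q *
    \sum_j \sum_l K p j * K q l * B j l ^+ 2).
  apply: eq_bigr => p _; rewrite -big_split/=; apply: eq_bigr => q _.
  rewrite -mulrDr; congr (_ * _).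
  have := kernel_bias_variance p q 0; rewrite sub0r sqrrN => <-.
  by do 2![apply: eq_bigr => ? _]; rewrite sub0r sqrrN.
(* Averaging the conditional laws [K p] gives back the measure of Y, so the second moments average
   to the squared diameter of Y. *)
have KY j : \sum_p weight X p * K p j = weight Y j.
  by rewrite -gY; apply: eq_bigr => p _; exact: weightK.
by rewrite -sum_mixture; do 2![apply: eq_bigr => ? _]; rewrite !KY.
Qed.

End projection.

Theorem theorem1 (R : realType) (X Y : network R) (gamma : X -> Y -> R)
    (weight_gt0 : forall i : X, 0 < weight X i)
    (gamma_opt : gw_optimal gamma) :
  let C := barycentric_cost gamma in
  let B := omega Y in
  let T := barycentric_projection gamma in
  GW2sq X Y = GW2sq X T
    + \sum_(i : X) \sum_(k : X) \sum_(j : Y) \sum_(l : Y)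
        gamma i j * gamma k l * `|C i k - B j l| ^+ 2
  /\
  GW2sq X Y = GW2sq X T + (diam2 Y ^+ 2 - diam2 T ^+ 2).
Proof.
move=> C B T; have gammaP := gamma_opt.1.
(* At the diagonal coupling, both costs in [gw_cost_compose] are attained by optimal couplings, so
   they become the two [GW2sq] values. *)
have cost_eq := gw_cost_compose _ _ _ _ weight_gt0 gammaP _
  (diag_couplingP _ _ _ gamma).
rewrite compose_diag// (gw_optimal_cost gamma_opt) in cost_eq.
rewrite (gw_optimal_cost (diag_optimal _ _ _ _ weight_gt0 gammaP gamma_opt))
  in cost_eq.
rewrite -variance_diam2// -cost_eq; split=> //.
rewrite cost_eq weighted_variance//; congr (_ + _).
by do 4![apply: eq_bigr => ? _]; rewrite real_normK ?num_real.
Qed.
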